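(* Let $a\ge 1$ and $b\ge 1$ be integers. Then the number $\dfrac{R_{ab}}{R_aR_b}$ is an integer if and only if $\gcd(a,b)=1$.
   Context: For an integer $n\ge 1$, the repunit $R_n$ is the natural number whose decimal expansion consists of exactly $n$ digits $1$, i.e. $R_n=(10^n-1)/9$. *)

(* Defs.v *)
From mathcomp Require Import all_boot all_order all_algebra.

Set Implicit Arguments.
Unset Strict Implicit.
Unset Printing Implicit Defensive.

(* Positional value of the decimal numeral made of n digits 1. *)
Definition repunit (n : nat) : nat := \sum_(i < n) 1 * 10 ^ i.

Lemma repunitE (n : nat) : repunit n = (10 ^ n - 1) %/ 9.
Proof.
suff -> : 10 ^ n - 1 = repunit n * 9 by rewrite mulnK.
rewrite /repunit subn1 predn_exp mulnC; congr (_ * _).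
by apply: eq_bigr => i _; rewrite mul1n.
Qed.

(* The division is exact. *)
Lemma dvdn9_repunit (n : nat) : 9 %| 10 ^ n - 1.
Proof. by rewrite subn1 predn_exp dvdn_mulr. Qed.

(* Main.v *)
Require Import Defs.
From mathcomp Require Import all_boot all_order all_algebra.
From mathcomp Require Import zify.
Import Order.TTheory GRing.Theory Num.Theory.
Local Open Scope ring_scope.

(** Write d for gcd(a, b).  The number R_(ab) / R_b is the sum of the a powers
    10^(bi), i < a ([repunit_mul]), so the quotient in question is an integer
    exactly when R_a divides this sum.  Every such power is 1 modulo R_d
    because d divides b, so the sum is congruent to a modulo R_d
    ([dvdn_sum_exp10]); and R_d divides R_a.  Hence integrality forces R_d to
    divide a, and by symmetry b, therefore d itself; this is impossible for
    d > 1 since then R_d > d ([dvdn_repunit_self]).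

    Conversely, if a and b are coprime then so are R_a and R_b
    ([coprime_repunit], from a Bezout relation between the indices), and both
    divide R_(ab), hence so does their product. *)

Lemma repunitS n : repunit n.+1 = (1 + 10 * repunit n)%N.
Proof.
rewrite /repunit big_ord_recl mul1n expn0; congr addn.
by rewrite big_distrr; apply: eq_bigr => i _; rewrite /= !mul1n expnS.
Qed.

Lemma expn10_repunit n : (10 ^ n = 1 + 9 * repunit n)%N.
Proof.
elim: n => [|n IHn]; first by rewrite /repunit big_ord0.
by rewrite expnS IHn repunitS; lia.
Qed.

Lemma repunitD m n : (repunit (m + n) = repunit m + 10 ^ m * repunit n)%N.
Proof.
elim: m => [|m IHm]; first by rewrite /repunit big_ord0 add0n mul1n.
by rewrite addSn !repunitS IHm mulnDr addnA expnS mulnA.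
Qed.

(** The string of a * b ones consists of a blocks of b ones. *)
Lemma repunit_mul a b :
  (repunit (a * b) = repunit b * \sum_(i < a) 10 ^ (b * i))%N.
Proof.
elim: a => [|a IHa]; first by rewrite /repunit !big_ord0 muln0.
by rewrite mulSnr repunitD IHa big_ord_recr /= mulnDr (mulnC a) (mulnC (10 ^ _)%N).
Qed.

Lemma dvdn_repunit d n : (d %| n)%N -> (repunit d %| repunit n)%N.
Proof. by case/dvdnP=> k ->; rewrite repunit_mul dvdn_mulr. Qed.

Lemma repunit_gt0 n : (0 < n)%N -> (0 < repunit n)%N.
Proof. by case: n => // n _; rewrite repunitS. Qed.

Lemma leq_repunit n : (n <= repunit n)%N.
Proof.
elim: n => // n IHn; rewrite repunitS add1n ltnS.
by apply: leq_trans IHn _; apply: leq_pmull.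
Qed.

(** A Bezout relation u * a = v * b + 1 gives
    R_(ua) = R_(vb+1) = 1 + 10 * R_(vb), so a common divisor of R_a and R_b,
    which divides both R_(ua) and R_(vb), divides 1. *)
Lemma coprime_repunit a b :
  (0 < a)%N -> coprime a b -> coprime (repunit a) (repunit b).
Proof.
move=> a_gt0 /(coprimeP b a_gt0)[[u v] /= uv1].
have uaE : (u * a = (v * b).+1)%N.
  have vb_lt : (v * b < u * a)%N by rewrite -subn_gt0 uv1.
  by rewrite -(subnK (ltnW vb_lt)) uv1.
rewrite /coprime -dvdn1; set g := gcdn _ _.
have gRu : (g %| repunit (u * a))%N.
  by apply: dvdn_trans (dvdn_gcdl _ _) (dvdn_repunit _ _ (dvdn_mull u (dvdnn a))).
have gRv : (g %| repunit (v * b))%N.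
  by apply: dvdn_trans (dvdn_gcdr _ _) (dvdn_repunit _ _ (dvdn_mull v (dvdnn b))).
by move: gRu; rewrite uaE repunitS dvdn_addl // dvdn_mull.
Qed.

(** Each power is 1 + 9 * R_(bi), and R_d divides R_(bi), so the sum is
    congruent to its number of terms modulo R_d. *)
Lemma dvdn_sum_exp10 d a b : (d %| b)%N ->
  (repunit d %| \sum_(i < a) 10 ^ (b * i))%N = (repunit d %| a)%N.
Proof.
move=> d_dv_b; under eq_bigr do rewrite expn10_repunit.
rewrite big_split /= sum1_card card_ord dvdn_addl //.
by apply: dvdn_sum => i _; rewrite dvdn_mull // dvdn_repunit // dvdn_mulr.
Qed.

Lemma dvdn_repunit_mul d a b : (0 < b)%N -> (d %| a)%N -> (d %| b)%N ->
  (repunit a * repunit b %| repunit (a * b))%N -> (repunit d %| a)%N.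
Proof.
move=> b_gt0 d_dv_a d_dv_b.
rewrite repunit_mul mulnC dvdn_pmul2l ?repunit_gt0 // => Ra_dv.
rewrite -(dvdn_sum_exp10 _ _ _ d_dv_b).
exact: dvdn_trans (dvdn_repunit _ _ d_dv_a) Ra_dv.
Qed.

(** With d = n + 1, divisibility gives 1 + 10 * R_n <= n + 1, while R_n >= n. *)
Lemma dvdn_repunit_self d : (0 < d)%N -> (repunit d %| d)%N -> d = 1%N.
Proof.
case: d => // n _ /(dvdn_leq (ltn0Sn n)).
by rewrite repunitS; have := leq_repunit n; lia.
Qed.

Lemma dvdn_repunit_mulE a b : (0 < a)%N -> (0 < b)%N ->
  (repunit a * repunit b %| repunit (a * b))%N = coprime a b.
Proof.
move=> a_gt0 b_gt0; apply/idP/idP => [Rab | co_ab].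
  apply/eqP/dvdn_repunit_self; first by rewrite gcdn_gt0 a_gt0.
  have Rba : (repunit b * repunit a %| repunit (b * a))%N.
    by rewrite mulnC (mulnC b).
  rewrite dvdn_gcd (dvdn_repunit_mul _ _ _ b_gt0 _ _ Rab) ?dvdn_gcdl ?dvdn_gcdr //.
  by rewrite (dvdn_repunit_mul _ _ _ a_gt0 _ _ Rba) ?dvdn_gcdl ?dvdn_gcdr.
rewrite Gauss_dvd ?coprime_repunit //.
by apply/andP; split; apply: dvdn_repunit; [apply: dvdn_mulr | apply: dvdn_mull].
Qed.

Lemma natr_div_int (m n : nat) : (0 < n)%N ->
  (m%:R / n%:R : rat) \is a Num.int = (n %| m)%N.
Proof.
move=> n_gt0; have n_neq0 : n%:R != 0 :> rat by rewrite pnatr_eq0 -lt0n.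
apply/idP/idP => [q_int | /dvdnP[k ->]]; last by rewrite natrM mulfK // rpred_nat.
have: (m%:R / n%:R : rat) \is a Num.nat.
  by rewrite natrEint q_int divr_ge0 ?ler0n.
case/natrP=> k /(canRL (divfK n_neq0)) /eqP.
by rewrite -natrM eqr_nat => /eqP->; apply: dvdn_mull.
Qed.

Theorem mainTheorem2 (a b : nat) (ha : (1 <= a)%N) (hb : (1 <= b)%N) :
  ((repunit (a * b))%:R / ((repunit a)%:R * (repunit b)%:R) : rat)
      \is a Num.int
  <-> gcdn a b = 1%N.
Proof.
rewrite -natrM natr_div_int ?muln_gt0 ?repunit_gt0 // dvdn_repunit_mulE //.
by split=> /eqP.
Qed.
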